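(* Let $1\le i<j\le n$. (i) Let $\mathfrak{g}=B_n^+$ and $f\in\mathfrak{g}^*$. Then $f\in O_{\epsilon_i+\epsilon_j}(1)$ if and only if $f$ satisfies $$f(e_\beta)=\begin{cases} 1 & \text{if }\beta=\epsilon_i+\epsilon_j,\\ f(e_{\epsilon_i-\epsilon_s})f(e_{\epsilon_r+\epsilon_j}) & \text{if }\beta=\epsilon_r-\epsilon_s,\ i\le r<s\le j,\\ f(e_{\epsilon_r+\epsilon_j})\Bigl(-\tfrac12 f(e_{\epsilon_i})^2+\sum_{k=j+1}^n (-1)^k f(e_{\epsilon_i-\epsilon_k})f(e_{\epsilon_i+\epsilon_k})\Bigr) & \text{if }\beta=\epsilon_r-\epsilon_j,\ i\le r<j,\\ f(e_{\epsilon_i\pm\epsilon_s})f(e_{\epsilon_r+\epsilon_j}) & \text{if }\beta=\epsilon_r\pm\epsilon_s,\ i<r<j<s\le n,\\ f(e_{\epsilon_j\pm\epsilon_s})f(e_{\epsilon_i+\epsilon_r})-f(e_{\epsilon_i\pm\epsilon_s})f(e_{\epsilon_j+\epsilon_r}) & \text{if }\beta=\epsilon_r\pm\epsilon_s,\ j<r<s\le n,\\ f(e_{\epsilon_i})f(e_{\epsilon_r+\epsilon_j}) & \text{if }\beta=\epsilon_r,\ i<r<j,\\ f(e_{\epsilon_j})f(e_{\epsilon_i+\epsilon_r})-f(e_{\epsilon_i})f(e_{\epsilon_j+\epsilon_r}) & \text{if }\beta=\epsilon_r,\ j<r\le n,\\ 0 & \text{otherwise}, \end{cases}$$ for all $\beta\in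 R(\epsilon_i+\epsilon_j)$, and $f$ takes arbitrary values on $e_\beta$ for all $\beta\in S(\epsilon_i+\epsilon_j)$. (ii) Let $\mathfrak{g}=D_n^+$ and $f\in\mathfrak{g}^*$. Then $f\in O_{\epsilon_i+\epsilon_j}(1)$ if and only if $f$ satisfies $$f(e_\beta)=\begin{cases} 1 & \text{if }\beta=\epsilon_i+\epsilon_j,\\ f(e_{\epsilon_i-\epsilon_s})f(e_{\epsilon_r+\epsilon_j}) & \text{if }\beta=\epsilon_r-\epsilon_s,\ i\le r<s\le j,\\ f(e_{\epsilon_r+\epsilon_j})\Bigl(\sum_{k=j+1}^n (-1)^k f(e_{\epsilon_i-\epsilon_k})f(e_{\epsilon_i+\epsilon_k})\Bigr) & \text{if }\beta=\epsilon_r-\epsilon_j,\ i\le r<j,\\ f(e_{\epsilon_i\pm\epsilon_s})f(e_{\epsilon_r+\epsilon_j}) & \text{if }\beta=\epsilon_r\pm\epsilon_s,\ i<r<j<s\le n,\\ f(e_{\epsilon_j\pm\epsilon_s})f(e_{\epsilon_i+\epsilon_r})-f(e_{\epsilon_i\pm\epsilon_s})f(e_{\epsilon_j+\epsilon_r}) & \text{if }\beta=\epsilon_r\pm\epsilon_s,\ j<r<s\le n,\\ 0 & \text{otherwise}, \end{cases}$$ for all $\beta\in R(\epsilon_i+\epsilon_j)$, and $f$ takes arbitrary values on $e_\beta$ for all $\beta\in S(\epsilon_i+\epsilon_j)$.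
   Context: All Lie algebras are over $\mathbb{C}$; $n$ is a positive integer; $E_{ab}$ denotes the matrix unit with $1$ in position $(a,b)$ and $0$ elsewhere. The symbols $\epsilon_1,\dots,\epsilon_n$ are the usual coordinate functionals on the diagonal Cartan subalgebra ($\epsilon_i$ is the projection onto the $(i,i)$ entry). Positive roots: $\Phi^+(B_n)=\{\epsilon_i\pm\epsilon_j:1\le i<j\le n\}\cup\{\epsilon_i:1\le i\le n\}$; $\Phi^+(D_n)=\{\epsilon_i\pm\epsilon_j:1\le i<j\le n\}$. The expressions $\epsilon_r+\epsilon_s$ and $\epsilon_s+\epsilon_r$ denote the same root, and signs $\pm$ within one line are taken consistently. $B_n^+$ is the Lie algebra of strictly upper triangular $(2n+1)\times(2n+1)$ matrices that are antisymmetric about the antidiagonal, with basis $e_{\epsilon_i-\epsilon_j}=E_{ij}-E_{2n+2-j,2n+2-i}$ ($1\le i<j\le n$), $e_{\epsilon_i}=E_{i,n+1}-E_{n+1,2n+2-i}$ ($1\le i\le n$), $e_{\epsilon_i+\epsilon_j}=E_{i,2n+2-j}-E_{j,2n+2-i}$ ($1\le i<j\le n$). $D_n^+$ is the Lie algebra of strictly upper triangular $2n\times 2n$ matrices that are antisymmetric about the antidiagonal, with basis $e_{\epsilon_i-\epsilon_j}=E_{ij}-E_{2n+1-j,2n+1-i}$, $e_{\epsilon_i+\epsilon_j}=E_{i,2n+1-j}-E_{j,2n+1-i}$ ($1\le i<j\le n$). Let $\Phi^+$ be the set of positive roots corresponding to $\mathfrak{g}$. For $\alpha\in\Phi^+$,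 the set $S(\alpha)$ of $\alpha$-singular roots is the union of all pairs $\{\beta,\gamma\}\subset\Phi^+$ with $\beta+\gamma=\alpha$, and the set of $\alpha$-regular roots is $R(\alpha)=\Phi^+\setminus S(\alpha)$. The group $G=\exp(\mathfrak{g})$ (matrix exponentials) acts on the dual space $\mathfrak{g}^*$ by the coadjoint action $(g.f)(x)=f(g^{-1}xg)$. Let $\{e_\alpha^*\}_{\alpha\in\Phi^+}$ be the basis of $\mathfrak{g}^*$ dual to $\{e_\alpha\}_{\alpha\in\Phi^+}$. For $c\in\mathbb{C}\setminus\{0\}$, the elementary orbit $O_\alpha(c)$ is the $G$-orbit of $c\,e_\alpha^*$ in $\mathfrak{g}^*$.
   Formalization: In the case β=ε_r−ε_j of (i) and (ii), the sign (-1)^k in the sum over k is replaced by -1; with the given basis the printed sign is false when some k>j is even (e.g. D_4, (i,j)=(1,2)). Where the lines for ε_r−ε_s (s=j) and ε_r−ε_j overlap, both values are imposed. *)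

(* Defs.v *)
(* The complex numbers are R[i], for R : realType. *)
From HB Require Import structures.
From mathcomp Require Import all_boot all_order all_algebra.
From mathcomp Require Import complex reals zify.

Set Implicit Arguments.
Unset Strict Implicit.
Unset Printing Implicit Defensive.

Import GRing.Theory.

Local Open Scope ring_scope.
Local Open Scope complex_scope.

Section AntisymmetricUpper.

Variables (R : realType) (N : nat).
Local Notation C := R[i].

(* With 0-based indices, the entry (a, b) is reflected in the antidiagonal to
   (rev_ord b, rev_ord a). *)
Definition antisym_upper : {pred 'M[C]_N} := fun x =>
  [forall a : 'I_N, forall b : 'I_N,
     ((b <= a)%N ==> (x a b == 0)) && (x (rev_ord b) (rev_ord a) == - x a b)].

Lemma antisym_upper_submod_closed : submod_closed antisym_upper.
Proof.
split=> [|c x y /forallP hx /forallP hy].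
  by apply/forallP => a; apply/forallP => b; rewrite !mxE oppr0 eqxx implybT.
apply/forallP => a; apply/forallP => b.
have /andP[/implyP x0 /eqP xs] := forallP (hx a) b.
have /andP[/implyP y0 /eqP ys] := forallP (hy a) b.
rewrite !mxE xs ys mulrN opprD eqxx andbT; apply/implyP => ba.
by rewrite (eqP (x0 ba)) (eqP (y0 ba)) mulr0 addr0.
Qed.

HB.instance Definition _ := GRing.isSubmodClosed.Build C 'M[C]_N antisym_upper
  antisym_upper_submod_closed.

Record nil_lie := NilLie
  { nil_lie_mx :> 'M[C]_N ; _ : nil_lie_mx \in antisym_upper }.

HB.instance Definition _ := [isSub for nil_lie_mx].
HB.instance Definition _ := [Choice of nil_lie by <:].
HB.instance Definition _ := [SubChoice_isSubLmodule of nil_lie by <:].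

(* On nil_lie the exponential series stops before its N-th term, by
   nil_lie_nilpotent. *)
Definition expmx (x : 'M[C]_N) : 'M[C]_N :=
  \sum_(k < N) (k`!%:R)^-1 *: x ^+ k.

Lemma nil_lie_nilpotent (x : nil_lie) (k : nat) :
  (N <= k)%N -> nil_lie_mx x ^+ k = 0.
Proof.
move=> Nk; case: x => x /= /forallP hx.
have x0 (a b : 'I_N) : (b <= a)%N -> x a b = 0.
  by move=> ba; have /andP[/implyP/(_ ba)/eqP] := forallP (hx a) b.
have xk0 m (a b : 'I_N) : (b < a + m)%N -> (x ^+ m) a b = 0.
  elim: m a b => [|m IHm] a b.
    by rewrite addn0 expr0 mxE => ba; case: eqP ba => // ->; rewrite ltnn.
  move=> bam; rewrite exprS mxE big1 // => c _.
  have [ca|ac] := leqP c a; first by rewrite x0 // mul0r.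
  rewrite IHm ?mulr0 //; apply: leq_trans bam _.
  by rewrite addnS -addSn leq_add2r.
apply/matrixP => a b; rewrite xk0 ?mxE //.
by apply: leq_trans (ltn_ord b) _; apply: leq_trans Nk (leq_addl _ _).
Qed.

Definition exp_group (g : 'M[C]_N) : Prop := exists x : nil_lie, g = expmx x.

(* f = g.phi, where (g.phi)(x) = phi (g^-1 x g). *)
Definition is_coadjoint (g : 'M[C]_N) (phi f : {scalar nil_lie}) : Prop :=
  forall x : nil_lie, exists2 y : nil_lie,
    nil_lie_mx y = invmx g *m nil_lie_mx x *m g & f x = phi y.

End AntisymmetricUpper.

Lemma antisym_upper_delta (R : realType) (N : nat) (a b : 'I_N) :
  (a < b)%N ->
  delta_mx a b - delta_mx (rev_ord b) (rev_ord a) \in @antisym_upper R N.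
Proof.
move=> ab; apply/forallP => c; apply/forallP => d; rewrite !mxE.
have rE (x y : 'I_N) : (rev_ord x == y) = (x == rev_ord y).
  by rewrite -{1}[y]rev_ordK (inj_eq rev_ord_inj).
rewrite !rE !rev_ordK opprB [(d == b) && _]andbC.
rewrite [(d == rev_ord a) && _]andbC eqxx andbT.
apply/implyP => dc; rewrite -!val_eqE /=.
have aN := ltn_ord a; have bN := ltn_ord b.
have -> : (c == a :> nat) && (d == b :> nat) = false by lia.
have -> : (c == N - b.+1 :> nat)%N && (d == N - a.+1 :> nat)%N = false by lia.
by rewrite subrr.
Qed.

(* Names for the functionals of types B and D: Sub i j is epsilon_i - epsilon_j,
   Add i j is epsilon_i + epsilon_j and Short i is epsilon_i.  Positive roots
   are named uniquely, since Sub and Add are only used with i < j. *)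
Inductive bdroot (n : nat) : Type :=
| Sub of 'I_n & 'I_n
| Add of 'I_n & 'I_n
| Short of 'I_n.

Definition PM (n : nat) (plus : bool) (r s : 'I_n) : bdroot n :=
  if plus then Add r s else Sub r s.

(* Coordinates with respect to epsilon_1, ..., epsilon_n. *)
Definition weight (n : nat) (b : bdroot n) : 'rV[int]_n :=
  match b with
  | Sub i j => delta_mx 0 i - delta_mx 0 j
  | Add i j => delta_mx 0 i + delta_mx 0 j
  | Short i => delta_mx 0 i
  end.

Definition posB (n : nat) (b : bdroot n) : bool :=
  match b with Sub i j | Add i j => (i < j)%N | Short _ => true end.

Definition posD (n : nat) (b : bdroot n) : bool :=
  match b with Sub i j | Add i j => (i < j)%N | Short _ => false end.

Definition singular (n : nat) (pos : pred (bdroot n)) (a b : bdroot n) : Prop :=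
  pos b /\ exists2 c, pos c & weight b + weight c = weight a.

Definition regular (n : nat) (pos : pred (bdroot n)) (a b : bdroot n) : Prop :=
  pos b /\ ~ singular pos a b.

Notation BLie R n := (nil_lie R n.*2.+1).
Notation DLie R n := (nil_lie R n.*2).

Section RootVectors.

Variables (R : realType) (n : nat).
Local Notation C := R[i].

Fact n_leB : (n <= n.*2.+1)%N.
Proof. by rewrite -addnn -addnS leq_addr. Qed.

Fact n_ltB : (n < n.*2.+1)%N.
Proof. by rewrite -addnn ltnS leq_addr. Qed.

Fact n_leD : (n <= n.*2)%N.
Proof. by rewrite -addnn leq_addr. Qed.

(* In 1-based terms, idxB and idxD send i to i, rev_ord sends a to 2n+2-a in
   type B and to 2n+1-a in type D, and midB is n+1. *)
Definition idxB (i : 'I_n) : 'I_n.*2.+1 := widen_ord n_leB i.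
Definition midB : 'I_n.*2.+1 := Ordinal n_ltB.
Definition idxD (i : 'I_n) : 'I_n.*2 := widen_ord n_leD i.

Definition eB_mx (b : bdroot n) : 'M[C]_(n.*2.+1) :=
  match b with
  | Sub i j => delta_mx (idxB i) (idxB j)
               - delta_mx (rev_ord (idxB j)) (rev_ord (idxB i))
  | Add i j => delta_mx (idxB i) (rev_ord (idxB j))
               - delta_mx (idxB j) (rev_ord (idxB i))
  | Short i => delta_mx (idxB i) midB - delta_mx midB (rev_ord (idxB i))
  end.

Definition eD_mx (b : bdroot n) : 'M[C]_(n.*2) :=
  match b with
  | Sub i j => delta_mx (idxD i) (idxD j)
               - delta_mx (rev_ord (idxD j)) (rev_ord (idxD i))
  | Add i j => delta_mx (idxD i) (rev_ord (idxD j))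
               - delta_mx (idxD j) (rev_ord (idxD i))
  | Short _ => 0
  end.

(* By eB_mxE and eD_mxE, the default 0 is never reached at a positive root. *)
Definition eB (b : bdroot n) : BLie R n := insubd (0 : BLie R n) (eB_mx b).
Definition eD (b : bdroot n) : DLie R n := insubd (0 : DLie R n) (eD_mx b).

Lemma eB_mxE (b : bdroot n) : posB b -> nil_lie_mx (eB b) = eB_mx b.
Proof.
move=> pb; rewrite /eB val_insubd ifT //; case: b pb => [i j|i j|i] pb.
- exact: antisym_upper_delta.
- rewrite /eB_mx -{2}[idxB j]rev_ordK antisym_upper_delta //=.
  by rewrite subSS; move: (ltn_ord i) (ltn_ord j); lia.
- have rmid : rev_ord midB = midB by apply: val_inj => /=; lia.
  by rewrite /eB_mx -{2}rmid antisym_upper_delta //=.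
Qed.

Lemma eD_mxE (b : bdroot n) : posD b -> nil_lie_mx (eD b) = eD_mx b.
Proof.
move=> pb; rewrite /eD val_insubd ifT //; case: b pb => [i j|i j|i] pb //.
- exact: antisym_upper_delta.
- rewrite /eD_mx -{2}[idxD j]rev_ordK antisym_upper_delta //=.
  by move: (ltn_ord i) (ltn_ord j); lia.
Qed.

End RootVectors.

Section Orbits.

Variables (R : realType) (n N : nat).
Variables (pos : pred (bdroot n)) (e : bdroot n -> nil_lie R N).
Local Notation C := R[i].

(* phi = c e_a^*. *)
Definition is_dual_multiple (a : bdroot n) (c : C) (phi : {scalar nil_lie R N})
  : Prop :=
  phi (e a) = c /\ forall b, pos b -> b <> a -> phi (e b) = 0.

Definition elementary_orbit (a : bdroot n) (c : C) (f : {scalar nil_lie R N})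
  : Prop :=
  exists2 phi : {scalar nil_lie R N}, is_dual_multiple a c phi &
  exists2 g, exp_group g & is_coadjoint g phi f.

End Orbits.

Section PrescribedValues.

Variables (R : realType) (n : nat) (i j : 'I_n).
Variable F : bdroot n -> R[i].

(* The value v that the case distinction attaches to the root b, when F b
   stands for f(e_b).  The cases overlap at epsilon_r - epsilon_j for
   i <= r < j, where both values are prescribed.

   The sum over k has the sign -1, where the published formula has (-1)^k:
   with the basis vectors eB and eD, the latter is wrong for even k.  For
   example in types B_4 and D_4, for (i, j) = (1, 2) and
   g = exp(a e_(2-4) + b e_(2+4)), the functional f = g.e_(1+2)^* has
   f(e_(1-4)) = - b, f(e_(1+4)) = - a and f(e_(1-2)) = - a b, while f(e_1)
   (in type B) and f(e_(1-3)) are 0. *)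
Inductive prescribedB : bdroot n -> R[i] -> Prop :=
| prescribedB_top : prescribedB (Add i j) 1
| prescribedB_sub (r s : 'I_n) : (i <= r)%N -> (r < s)%N -> (s <= j)%N ->
    prescribedB (Sub r s) (F (Sub i s) * F (Add r j))
| prescribedB_subj (r : 'I_n) : (i <= r)%N -> (r < j)%N ->
    prescribedB (Sub r j)
      (F (Add r j) * (- 2^-1 * F (Short i) ^+ 2
         - \sum_(k < n | (j < k)%N) F (Sub i k) * F (Add i k)))
| prescribedB_mid (plus : bool) (r s : 'I_n) :
    (i < r)%N -> (r < j)%N -> (j < s)%N ->
    prescribedB (PM plus r s) (F (PM plus i s) * F (Add r j))
| prescribedB_far (plus : bool) (r s : 'I_n) : (j < r)%N -> (r < s)%N ->
    prescribedB (PM plus r s)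
      (F (PM plus j s) * F (Add i r) - F (PM plus i s) * F (Add j r))
| prescribedB_short_mid (r : 'I_n) : (i < r)%N -> (r < j)%N ->
    prescribedB (Short r) (F (Short i) * F (Add r j))
| prescribedB_short_far (r : 'I_n) : (j < r)%N ->
    prescribedB (Short r)
      (F (Short j) * F (Add i r) - F (Short i) * F (Add j r)).

Inductive prescribedD : bdroot n -> R[i] -> Prop :=
| prescribedD_top : prescribedD (Add i j) 1
| prescribedD_sub (r s : 'I_n) : (i <= r)%N -> (r < s)%N -> (s <= j)%N ->
    prescribedD (Sub r s) (F (Sub i s) * F (Add r j))
| prescribedD_subj (r : 'I_n) : (i <= r)%N -> (r < j)%N ->
    prescribedD (Sub r j)
      (F (Add r j) * - \sum_(k < n | (j < k)%N) F (Sub i k) * F (Add i k))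
| prescribedD_mid (plus : bool) (r s : 'I_n) :
    (i < r)%N -> (r < j)%N -> (j < s)%N ->
    prescribedD (PM plus r s) (F (PM plus i s) * F (Add r j))
| prescribedD_far (plus : bool) (r s : 'I_n) : (j < r)%N -> (r < s)%N ->
    prescribedD (PM plus r s)
      (F (PM plus j s) * F (Add i r) - F (PM plus i s) * F (Add j r)).

End PrescribedValues.

Definition takes_values (n : nat) (T : nmodType) (D : bdroot n -> Prop)
    (prescribed : bdroot n -> T -> Prop) (F : bdroot n -> T) : Prop :=
  forall b, D b ->
    (forall v, prescribed b v -> F b = v)
    /\ ((forall v, ~ prescribed b v) -> F b = 0).

(* Main.v *)
From HB Require Import structures.
From mathcomp Require Import all_boot all_order all_algebra.
From mathcomp Require Import complex reals boolp zify ring.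
Require Import Defs.

Set Implicit Arguments.
Unset Strict Implicit.
Unset Printing Implicit Defensive.

Import GRing.Theory Num.Theory.

Local Open Scope ring_scope.
Local Open Scope complex_scope.

(** Let N be the size of the matrices, and write c' for the reflected index
    rev c.  The matrices that are antisymmetric about the antidiagonal are the
    skew-adjoint ones for the symmetric form (u, v) = sum of the u_c v_c', so the
    group consists of upper unitriangular isometries (expmx_isometry), and the
    inverse of g is its adjoint.

    The functional dual to the root vector of epsilon_i + epsilon_j is
    x |-> x_(i, j') (matrix_entry_dual).  Its translate by g therefore only
    depends on the columns p of index j' and q of index i' of g, and its value at
    the matrix E_ab - E_b'a' is the minor q_a' p_b - q_b p_a'
    (conj_skew_delta).  Here p_j' = q_i' = 1 and both columns vanish below these
    entries; after subtraction of a multiple of p from q, also q_j' = 0.  Then the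
    minors at the singular roots are, up to sign, the remaining coordinates p_b
    with i < b < j', b <> j and q_b with j < b < i', b <> j'.  The relation
    (p, p) = 0 gives p_j in terms of the other p_b, and no other coordinate enters
    a minor at a root.  Writing the minors at the regular roots in terms of those
    at the singular ones gives the table of prescribed values
    (plucker_takes_values).

    All values of the free coordinates occur: an explicit element y, supported
    on two rows and two columns, has an exponential with given columns
    (expmx_with_columns).  So the values at the singular roots are arbitrary
    (orbit_with_singular_values).  As the table determines a functional from
    these values, a functional that follows the table is the point of the orbit
    with the same values at the singular roots (takes_values_orbit).

    Both types are treated together.  The boolean short tells whether there are
    short roots, that is, whether there is a middle index, and
    N = short + 2 n.  In type D, the table of type B is used with value 0 at the
    missing short roots (prescribedD_B). *)

(** * The exponential of a nilpotent antisymmetric matrix *)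

Section TruncatedExponential.

Variables (K : numFieldType).

(** The coefficient of degree m in exp(X) exp(-X), by the binomial theorem for
    (1 - 1)^m. *)
Lemma fact_conv_alternating (m : nat) :
  \sum_(k < m.+1) (k`!%:R)^-1 * ((-1) ^+ (m - k) * ((m - k)`!%:R)^-1)
    = (m == 0)%:R :> K.
Proof.
have m0 : m`!%:R != 0 :> K by rewrite pnatr_eq0 -lt0n fact_gt0.
apply: (mulfI m0).
transitivity ((-1 + 1) ^+ m : K).
  rewrite exprDn mulr_sumr; apply: eq_bigr => k _.
  have km : (k <= m)%N by rewrite -ltnS.
  have k0 : k`!%:R != 0 :> K by rewrite pnatr_eq0 -lt0n fact_gt0.
  have mk0 : (m - k)`!%:R != 0 :> K by rewrite pnatr_eq0 -lt0n fact_gt0.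
  rewrite -(bin_fact km) !natrM expr1n mulr1 -mulr_natr.
  by field; rewrite k0 mk0.
by rewrite addNr expr0n; case: m m0 => [|m] _ /=; rewrite ?fact0 ?mulr1 ?mulr0.
Qed.

End TruncatedExponential.

Section Group.

Variables (R : realType) (N : nat).
Local Notation C := R[i].
Implicit Types (x y : nil_lie R N) (a b c : 'I_N).

(** The product of the truncated series of exp(X) and exp(-X) is 1 modulo X^N,
    and X^N vanishes at z. *)
Lemma expmx_mulN (z : 'M[C]_N) : z ^+ N = 0 -> expmx z *m expmx (- z) = 1%:M.
Proof.
case: N z => [|n] z zN; first by apply/matrixP => -[].
pose p1 : {poly C} := \poly_(k < n.+1) (k`!%:R)^-1.
pose p2 : {poly C} := \poly_(k < n.+1) ((-1) ^+ k * (k`!%:R)^-1).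
have e1 : horner_mx z p1 = expmx z.
  rewrite /p1 poly_def linear_sum; apply: eq_bigr => k _.
  by rewrite linearZ /= rmorphXn /= horner_mx_X.
have e2 : horner_mx z p2 = expmx (- z).
  rewrite /p2 poly_def linear_sum; apply: eq_bigr => k _.
  by rewrite linearZ /= rmorphXn /= horner_mx_X -[- z]scaleN1r exprZn
     scalerA mulrC.
have e : take_poly n.+1 (p1 * p2) = 1.
  apply/polyP => m; rewrite coef_take_poly coef1.
  case: ltnP => [mn|nm]; last by case: m nm.
  rewrite coefM -fact_conv_alternating; apply: eq_bigr => k _.
  rewrite !coef_poly !ifT //; first by apply: leq_ltn_trans mn; exact: leq_subr.
  by apply: leq_trans (ltn_ord k) _.
rewrite -e1 -e2 -[_ *m _]/(_ * _) -rmorphM -[p1 * p2](poly_take_drop n.+1) e.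
by rewrite rmorphD rmorph1 rmorphM rmorphXn /= horner_mx_X zN mulr0 addr0.
Qed.

(** The adjoint of z for the symmetric bilinear form
    (u, v) |-> sum of the u_c v_(rev c). *)
Definition antitr (z : 'M[C]_N) : 'M[C]_N :=
  \matrix_(a, b) z (rev_ord b) (rev_ord a).

Lemma antitrM (z t : 'M[C]_N) : antitr (z *m t) = antitr t *m antitr z.
Proof.
apply/matrixP => a b; rewrite !mxE (reindex_inj rev_ord_inj).
by apply: eq_bigr => c _; rewrite !mxE mulrC.
Qed.

Lemma antitr1 : antitr 1%:M = 1%:M.
Proof. by apply/matrixP => a b; rewrite !mxE (inj_eq rev_ord_inj) eq_sym. Qed.

Lemma antitrX (z : 'M[C]_N) k : antitr (z ^+ k) = antitr z ^+ k.
Proof.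
elim: k => [|k IHk]; first exact: antitr1.
by rewrite exprS exprSr -IHk; exact: antitrM.
Qed.

Lemma antisym_upperP (z : 'M[C]_N) :
  reflect ((forall a b, (b <= a)%N -> z a b = 0) /\ antitr z = - z)
          (z \in @antisym_upper R N).
Proof.
apply: (iffP forallP) => [hz | [z0 zN] a].
  split=> [a b ba|].
    by have /forallP/(_ b)/andP[/implyP/(_ ba)/eqP] := hz a.
  apply/matrixP => a b; rewrite !mxE.
  by have /forallP/(_ b)/andP[_ /eqP] := hz a.
apply/forallP => b; apply/andP; split; first by apply/implyP => /z0 ->.
by move/matrixP/(_ a b): zN; rewrite !mxE => ->.
Qed.

Lemma nil_lie_upper x a b : (b <= a)%N -> nil_lie_mx x a b = 0.
Proof. by case: x => z hz; have [z0 _] := antisym_upperP _ hz; apply: z0. Qed.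

Lemma antitr_nil_lie x : antitr (nil_lie_mx x) = - nil_lie_mx x.
Proof. by case: x => z hz; have [] := antisym_upperP _ hz. Qed.

Lemma antitr_expmx x : antitr (expmx x) = expmx (- nil_lie_mx x).
Proof.
have <- : expmx (antitr x) = expmx (- nil_lie_mx x) by rewrite antitr_nil_lie.
apply/matrixP => a b; rewrite mxE [LHS]summxE [RHS]summxE.
by apply: eq_bigr => k _; rewrite -antitrX !mxE.
Qed.

(** exp(x) is an isometry because x is skew-adjoint; the columns of exp(x)
    inherit from this the quadratic relations that cut out the orbit. *)
Lemma expmx_isometry x : antitr (expmx x) *m expmx x = 1%:M.
Proof.
apply: mulmx1C; rewrite antitr_expmx expmx_mulN //; exact: nil_lie_nilpotent.
Qed.

Lemma invmx_expmx x : invmx (expmx x) = antitr (expmx x).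
Proof.
have h := expmx_isometry x; have [_ u] := mulmx1_unit h.
by rewrite -[RHS]mulmx1 -(mulmxV u) mulmxA h mul1mx.
Qed.

Lemma nil_lie_exp_upper x k a b : (b < a + k)%N -> (nil_lie_mx x ^+ k) a b = 0.
Proof.
elim: k a b => [|k IHk] a b bak.
  by rewrite expr0 mxE; case: eqP bak => // ->; rewrite addn0 ltnn.
rewrite exprS mxE big1 // => c _.
have [ca|ac] := leqP c a; first by rewrite nil_lie_upper ?mul0r.
by rewrite IHk ?mulr0 //; lia.
Qed.

Lemma expmx_upper x a b : (b <= a)%N -> expmx x a b = (a == b)%:R.
Proof.
move=> ba; have N0 : (0 < N)%N by case: N a {b ba} => [[]|].
rewrite summxE (bigD1 (Ordinal N0)) //= big1 => [|k]; last first.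
  rewrite -val_eqE /= -lt0n => k0.
  by rewrite mxE nil_lie_exp_upper ?mulr0 //; lia.
by rewrite addr0 !mxE fact0 invr1 mul1r.
Qed.

Lemma conj_antisym_upper x y :
  antitr (expmx x) *m nil_lie_mx y *m expmx x \in @antisym_upper R N.
Proof.
have antitrK z : antitr (antitr z) = z.
  by apply/matrixP => a b; rewrite !mxE !rev_ordK.
apply/antisym_upperP; split=> [a b ba|]; last first.
  by rewrite !antitrM antitr_nil_lie antitrK mulmxA mulmxN mulNmx.
rewrite mxE big1 // => c _.
have [cb|bc] := leqP c b; last first.
  rewrite [expmx x c b]expmx_upper 1?ltnW // -val_eqE gtn_eqF ?mulr0 //.
rewrite mxE big1 ?mul0r // => d _.
have [ad|da] := leqP a d.
  by rewrite nil_lie_upper ?mulr0 //; lia.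
rewrite mxE expmx_upper /=; last by lia.
by rewrite (inj_eq rev_ord_inj) -val_eqE ltn_eqF ?mul0r.
Qed.

End Group.

(** * Coordinates on the orbit of a matrix entry *)

Section Plucker.

Variables (R : realType) (N : nat).
Local Notation C := R[i].
Implicit Types (x y : nil_lie R N) (a b c : 'I_N) (p q : 'I_N -> C).

Definition skew_delta a b : 'M[C]_N :=
  delta_mx a b - delta_mx (rev_ord b) (rev_ord a).

(** The 2 x 2 minor of the pair (q, p) on the coordinates rev a and b. *)
Definition plucker p q a b : C := q (rev_ord a) * p b - q b * p (rev_ord a).

Lemma skew_delta_rev a b :
  skew_delta (rev_ord b) (rev_ord a) = - skew_delta a b.
Proof. by rewrite /skew_delta !rev_ordK opprB. Qed.

Lemma mulmx_delta_mulmx (A B : 'M[C]_N) a b r c :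
  (A *m delta_mx a b *m B) r c = A r a * B b c.
Proof.
rewrite -(mul_delta_mx (0 : 'I_1)) mulmxA -colE -mulmxA -rowE mxE big_ord1.
by rewrite !mxE.
Qed.

(** The inverse of an isometry g is its adjoint, so that its row r is, up to the
    reflection of indices, the column rev r of g.  Hence conjugation by g turns
    the entry (r, rev c) into a minor of two columns of g. *)
Lemma conj_skew_delta (g : 'M[C]_N) a b r c :
  (antitr g *m skew_delta a b *m g) r (rev_ord c)
  = plucker (g^~ (rev_ord c)) (g^~ (rev_ord r)) a b.
Proof.
rewrite /skew_delta mulmxBr mulmxBl mxE [X in _ + X]mxE !mulmx_delta_mulmx !mxE.
by rewrite rev_ordK.
Qed.

(** The coadjoint orbit of the functional x |-> x_(r, rev c), with the inverse of
    a group element written as its adjoint. *)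
Definition orbit_of_entry (r c : 'I_N) (f : {scalar nil_lie R N}) : Prop :=
  exists y, forall x,
    f x = (antitr (expmx y) *m nil_lie_mx x *m expmx y) r (rev_ord c).

Variables I J : 'I_N.
Hypotheses (IJ : (I < J)%N) (JJ : (J < rev_ord J)%N).

(** What remains of the columns rev J (for p) and rev I (for q) of an element of
    the group.  The minors of (q, p) do not change when a multiple of p is
    subtracted from q, which allows q (rev J) = 0; p is isotropic as g is an
    isometry.  Among the relations between two orthogonal isotropic
    columns, this is the one that binds coordinates occurring in the minors at
    positions above the diagonal. *)
Definition normalized_pair p q : Prop :=
  [/\ p (rev_ord J) = 1 /\ (forall c, (rev_ord J < c)%N -> p c = 0),
      q (rev_ord I) = 1 /\ (forall c, (rev_ord I < c)%N -> q c = 0),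
      q (rev_ord J) = 0
    & \sum_c p c * p (rev_ord c) = 0].

Lemma expmx_normalized_pair y :
  let g := expmx y in
  exists p q, [/\ normalized_pair p q,
    (forall a b, plucker p q a b
       = plucker (g^~ (rev_ord J)) (g^~ (rev_ord I)) a b),
    p =1 g^~ (rev_ord J)
  & g (rev_ord J) (rev_ord I) = 0 -> q =1 g^~ (rev_ord I)].
Proof.
move=> g; pose p := g^~ (rev_ord J); pose k := g (rev_ord J) (rev_ord I).
have gE (c d : 'I_N) : (d <= c)%N -> g c d = (c == d)%:R by apply: expmx_upper.
exists p, (fun c => g c (rev_ord I) - k * p c).
have pJ : p (rev_ord J) = 1 by rewrite /p gE // eqxx.
have p0 c : (rev_ord J < c)%N -> p c = 0.
  by move=> Jc; rewrite /p gE ?(ltnW Jc) // -val_eqE gtn_eqF.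
split.
- split=> //.
  + split=> [|c Ic].
      rewrite gE // eqxx p0 ?mulr0 ?subr0 //=.
      by move: (ltn_ord J); lia.
    rewrite gE ?(ltnW Ic) // -val_eqE gtn_eqF // p0 ?mulr0 ?subr0 //=.
    by move: Ic => /=; move: (ltn_ord J); lia.
  + by rewrite pJ mulr1 subrr.
  + have /matrixP/(_ J (rev_ord J)) := expmx_isometry y.
    rewrite !mxE -val_eqE ltn_eqF // => pp; apply: etrans pp.
    apply: eq_bigr => c _.
    by rewrite !mxE mulrC.
- by move=> a b; rewrite /plucker /p; ring.
- by [].
- by rewrite /k => k0 c; rewrite k0 mul0r subr0.
Qed.

Lemma orbit_plucker (f : {scalar nil_lie R N}) : orbit_of_entry I J f ->
  exists p q, normalized_pair p q /\
    forall a b x, nil_lie_mx x = skew_delta a b -> f x = plucker p q a b.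
Proof.
case=> y fE; have [p [q [pq pl _ _]]] := expmx_normalized_pair y.
by exists p, q; split=> // a b x xE; rewrite fE xE conj_skew_delta pl.
Qed.

(** Conversely, the coordinates of the two columns that stay free are arbitrary.
    The witness is the exponential of the antisymmetric matrix supported on the
    columns rev I, rev J and on the rows I, J.  In its powers of exponent at
    least 2 only the rows I and J are nonzero, so outside these rows the
    exponential is 1 + z. *)
Lemma expmx_with_columns (p q : 'I_N -> C) :
  exists y, let g := expmx y in
    [/\ forall c, (I < c < rev_ord J)%N -> c != J -> g c (rev_ord J) = p c,
        forall c, (J < c < rev_ord I)%N -> c != rev_ord J ->
          g c (rev_ord I) = q c
      & g (rev_ord J) (rev_ord I) = 0].
Proof.
pose P c := if (I < c < rev_ord J)%N && (c != J) then p c else 0.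
pose Q c := if (J < c < rev_ord I)%N && (c != rev_ord J) then q c else 0.
have IN := ltn_ord I; have JN := ltn_ord J; have JJ' := JJ; simpl in JJ'.
have P0 c : ~~ ((I < c < rev_ord J)%N && (c != J)) -> P c = 0.
  by rewrite /P => /negbTE ->.
have Q0 c : ~~ ((J < c < rev_ord I)%N && (c != rev_ord J)) -> Q c = 0.
  by rewrite /Q => /negbTE ->.
pose z : 'M[C]_N := \matrix_(r, c)
  ((c == rev_ord J)%:R * P r + (c == rev_ord I)%:R * Q r
   - (r == J)%:R * P (rev_ord c) - (r == I)%:R * Q (rev_ord c)).
have revE (c d : 'I_N) : (rev_ord c == d) = (c == rev_ord d).
  by rewrite -{1}[d]rev_ordK (inj_eq rev_ord_inj).
have zN : z \in antisym_upper (N := N).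
  apply/antisym_upperP; split=> [r c cr|]; last first.
    apply/matrixP => r c; rewrite !mxE !revE !rev_ordK; ring.
  have e1 : (c == rev_ord J)%:R * P r = 0.
    by case: eqP => [cE|_]; rewrite ?mul0r // P0 ?mulr0 // -cE; lia.
  have e2 : (c == rev_ord I)%:R * Q r = 0.
    by case: eqP => [cE|_]; rewrite ?mul0r // Q0 ?mulr0 // -cE; lia.
  have e3 : (r == J)%:R * P (rev_ord c) = 0.
    by case: eqP => [rE|_]; rewrite ?mul0r // P0 ?mulr0 //= -rE; lia.
  have e4 : (r == I)%:R * Q (rev_ord c) = 0.
    by case: eqP => [rE|_]; rewrite ?mul0r // Q0 ?mulr0 //= -rE; lia.
  by rewrite mxE e1 e2 e3 e4 addr0 !subr0.
pose y := NilLie zN; exists y.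
have z0 r c : r = rev_ord J \/ r = rev_ord I -> z r c = 0.
  move=> rE; have Jr : (rev_ord J <= r)%N by case: rE => -> /=; lia.
  have Pr : P r = 0 by rewrite P0 //; move: Jr; lia.
  have Qr : Q r = 0.
    by case: rE => ->; rewrite Q0 // ?eqxx ?andbF // ltnn !andbF.
  rewrite mxE Pr Qr -!(val_eqE r) /= !mulr0.
  by rewrite !gtn_eqF ?mul0r ?addr0 ?subr0 //; move: Jr => /=; lia.
have zE r c : r != I -> r != J ->
    z r c = (c == rev_ord J)%:R * P r + (c == rev_ord I)%:R * Q r.
  by move=> /negbTE rI /negbTE rJ; rewrite mxE rI rJ !mul0r !subr0.
have zX0 k r c : r = rev_ord J \/ r = rev_ord I -> (z ^+ k.+1) r c = 0.
  by move=> rE; rewrite exprS mxE big1 // => d _; rewrite z0 ?mul0r.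
have zX k r c : r != I -> r != J -> (z ^+ k.+2) r c = 0.
  move=> rI rJ; rewrite exprS mxE big1 // => d _; rewrite zE //.
  case: eqP => [->|_]; first by rewrite zX0 ?mulr0 //; left.
  case: eqP => [->|_]; first by rewrite zX0 ?mulr0 //; right.
  by rewrite !mul0r addr0 mul0r.
have N0 : (0 < N)%N by lia.
have N1 : (1 < N)%N by lia.
have gE r c : r != I -> r != J -> expmx z r c = (r == c)%:R + z r c.
  move=> rI rJ; rewrite summxE (bigD1 (Ordinal N0)) //=.
  rewrite (bigD1 (Ordinal N1)) //= big1 => [|k].
    by rewrite addr0 expr1 expr0 invr1 !scale1r !mxE.
  by case: k => -[|[|k]] //= kN _; rewrite mxE zX ?mulr0.
have JI : (rev_ord J == rev_ord I) = false.
  by rewrite (inj_eq rev_ord_inj) -val_eqE gtn_eqF.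
split=> [c cJ cJ'|c cI cJ'|].
- rewrite gE //; last by rewrite -val_eqE /=; lia.
  rewrite zE //; last by rewrite -val_eqE /=; lia.
  rewrite JI eqxx mul0r mul1r addr0 -val_eqE ltn_eqF ?add0r;
    last by case/andP: cJ.
  by rewrite /P cJ cJ'.
- have cI0 : c != I by rewrite -val_eqE /=; lia.
  have cJ0 : c != J by rewrite -val_eqE /=; lia.
  rewrite gE // zE // [rev_ord I == _]eq_sym JI eqxx mul0r mul1r add0r.
  by rewrite -val_eqE ltn_eqF ?add0r /Q ?cI ?cJ' //; case/andP: cI.
- by rewrite gE ?z0 ?JI ?addr0 //; [left|rewrite -val_eqE /=; lia..].
Qed.

Definition entry_orbit_point y r c x : C :=
  (antitr (expmx y) *m nil_lie_mx x *m expmx y) r c.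

Lemma entry_orbit_point_linear y r c : scalar (entry_orbit_point y r c).
Proof.
move=> k x x'; rewrite /entry_orbit_point.
have -> : nil_lie_mx (k *: x + x') = k *: nil_lie_mx x + nil_lie_mx x' by [].
by rewrite mulmxDr mulmxDl -scalemxAr -scalemxAl mxE [X in X + _]mxE.
Qed.

HB.instance Definition _ y r c := GRing.isLinear.Build C (nil_lie R N) C _
  (entry_orbit_point y r c) (entry_orbit_point_linear y r c).

End Plucker.

Section Coadjoint.

Variables (R : realType) (N : nat).
Local Notation C := R[i].
Implicit Types (x y : nil_lie R N) (a b c : 'I_N) (p q : 'I_N -> C).
Implicit Types f phi : {scalar nil_lie R N}.

Lemma coadjoint_orbit_of_entry (I J : 'I_N) phi f :
  (forall x, phi x = nil_lie_mx x I (rev_ord J)) ->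
  (exists2 g, exp_group g & is_coadjoint g phi f) <-> orbit_of_entry I J f.
Proof.
move=> phiE; split=> [[_ [y ->] fE] | [y fE]].
  exists y => x; have [t tE ->] := fE x.
  by rewrite phiE tE invmx_expmx.
exists (expmx y); first by exists y.
move=> x; exists (NilLie (conj_antisym_upper y x)).
  by rewrite invmx_expmx.
by rewrite phiE fE.
Qed.

Lemma orbit_realize (I J : 'I_N) p q : (I < J)%N -> (J < rev_ord J)%N ->
  exists2 f : {scalar nil_lie R N}, orbit_of_entry I J f &
  exists p0 q0,
  [/\ normalized_pair I J p0 q0,
      forall a b x, nil_lie_mx x = skew_delta R a b -> f x = plucker p0 q0 a b,
      forall c, (I < c < rev_ord J)%N -> c != J -> p0 c = p c
    & forall c, (J < c < rev_ord I)%N -> c != rev_ord J -> q0 c = q c].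
Proof.
move=> IJ JJ; have [y [gp gq g0]] := expmx_with_columns IJ JJ p q.
exists (entry_orbit_point y I (rev_ord J)); first by exists y.
have [p0 [q0 [nf pl p0E q0E]]] := expmx_normalized_pair IJ JJ y.
exists p0, q0; split=> //.
- by move=> a b x xE; rewrite /= /entry_orbit_point xE conj_skew_delta pl.
- by move=> c cJ cJ'; rewrite p0E gp.
- by move=> c cJ cJ'; rewrite q0E // gq.
Qed.

(** These matrices span the Lie algebra: twice x is the difference of x and its
    adjoint. *)
Lemma eq_on_skew_delta f f' :
  (forall a b x, (a < b)%N -> nil_lie_mx x = skew_delta R a b -> f x = f' x) ->
  f =1 f'.
Proof.
move=> ff' x.
have [e eE] : exists e : 'I_N -> 'I_N -> nil_lie R N,
    forall a b, (a < b)%N -> nil_lie_mx (e a b) = skew_delta R a b.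
  exists (fun a b => insubd (0 : nil_lie R N) (skew_delta R a b)) => a b ab.
  by rewrite val_insubd ifT //; apply: antisym_upper_delta.
have -> : x = 2^-1 *: \sum_(u : 'I_N * 'I_N | (u.1 < u.2)%N)
    nil_lie_mx x u.1 u.2 *: e u.1 u.2.
  apply: (scalerI (a := 2)); first by rewrite pnatr_eq0.
  rewrite scalerA mulfV ?pnatr_eq0 // scale1r; apply: val_inj => /=.
  have val_sum r (P : pred ('I_N * 'I_N)) (F : _ -> nil_lie R N) :
      nil_lie_mx (\sum_(u <- r | P u) F u)
      = \sum_(u <- r | P u) nil_lie_mx (F u).
    exact: (@big_morph _ _ (@nil_lie_mx R N) 0 +%R 0 +%R (fun _ _ => erefl)).
  have xD : nil_lie_mx x = \sum_(u : 'I_N * 'I_N | (u.1 < u.2)%N)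
      nil_lie_mx x u.1 u.2 *: delta_mx u.1 u.2.
    rewrite {1}[nil_lie_mx x]matrix_sum_delta pair_bigA /=.
    rewrite [LHS](bigID (fun u : 'I_N * 'I_N => (u.1 < u.2)%N)) /=.
    rewrite [X in _ + X]big1 ?addr0 // => u; rewrite -leqNgt => u21.
    by rewrite nil_lie_upper ?scale0r.
  rewrite scaler_nat mulr2n {1}xD -[X in _ + X]opprK -antitr_nil_lie val_sum.
  have -> : antitr (nil_lie_mx x) = \sum_(u : 'I_N * 'I_N | (u.1 < u.2)%N)
      nil_lie_mx x u.1 u.2 *: delta_mx (rev_ord u.2) (rev_ord u.1).
    rewrite {1}xD; apply/matrixP => r c; rewrite mxE !summxE.
    apply: eq_bigr => u _; rewrite !mxE -[u.1]rev_ordK -[u.2]rev_ordK.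
    by rewrite !(inj_eq rev_ord_inj) !rev_ordK andbC.
  rewrite -sumrB; apply: eq_bigr => u u12.
  by rewrite -scalerBr -[LHS]/(_ *: skew_delta R u.1 u.2) -eE.
rewrite !linearZ !linear_sum; congr (_ *: _); apply: eq_bigr => u u12.
by rewrite !linearZ (ff' u.1 u.2) ?eE.
Qed.

End Coadjoint.

(** * Singular roots *)

Section SingularRoots.

Variable n : nat.
Implicit Types (i j k r s : 'I_n) (b c : bdroot n).

Definition pos_root (short : bool) : pred (bdroot n) :=
  if short then @posB n else @posD n.

(** The roots that occur in a decomposition of epsilon_i + epsilon_j as
    (epsilon_i -+ epsilon_s) + (epsilon_j +- epsilon_s), or as the sum of the
    short roots epsilon_i and epsilon_j. *)
Definition singularb (short : bool) i j b : bool :=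
  match b with
  | Sub r s => (r < s)%N && ((r == i) && (s != j) || (r == j))
  | Add r s =>
      (r < s)%N && [|| (r == i) && (j < s)%N, (s == j) && (i < r)%N | r == j]
  | Short r => short && ((r == i) || (r == j))
  end.

Lemma pos_rootE short b : pos_root short b =
  match b with Sub r s | Add r s => (r < s)%N | Short _ => short end.
Proof. by rewrite /pos_root; case: short b => -[]. Qed.

Lemma weightE b k : weight b 0 k =
  match b with
  | Sub r s => (k == r)%:R - (k == s)%:R
  | Add r s => (k == r)%:R + (k == s)%:R
  | Short r => (k == r)%:R
  end.
Proof. by case: b => *; rewrite !mxE. Qed.

Lemma singularb_singular short i j b : (i < j)%N -> singularb short i j b ->
  singular (pos_root short) (Add i j) b.
Proof.
move=> ij hb.
suff [c cp cE] : exists2 c, pos_root short c &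
    forall k, weight b 0 k + weight c 0 k = weight (Add i j) 0 k.
  split; first by rewrite pos_rootE; case: b hb {cE} => [r s|r s|r] /andP[].
  by exists c => //; apply/rowP => k; rewrite mxE cE.
case: b hb => [r s|r s|r]; rewrite /singularb => /andP[rs].
- case/orP=> [/andP[/eqP ri sj]|/eqP rj].
  + subst r; have [sltj|jlts|/ord_inj se] := ltngtP s j.
    * exists (Add s j); first by rewrite pos_rootE.
      by move=> k; rewrite !weightE; ring.
    * exists (Add j s); first by rewrite pos_rootE.
      by move=> k; rewrite !weightE; ring.
    * by rewrite se eqxx in sj.
  + subst r; exists (Add i s); first by rewrite pos_rootE; lia.
    by move=> k; rewrite !weightE; ring.
- case/or3P=> [/andP[/eqP ri js]|/andP[/eqP sj ir]|/eqP rj].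
  + subst r; exists (Sub j s); first by rewrite pos_rootE.
    by move=> k; rewrite !weightE; ring.
  + subst s; exists (Sub i r); first by rewrite pos_rootE.
    by move=> k; rewrite !weightE; ring.
  + subst r; exists (Sub i s); first by rewrite pos_rootE; lia.
    by move=> k; rewrite !weightE; ring.
- case/orP=> /eqP re; subst r.
  + exists (Short j); first by rewrite pos_rootE.
    by move=> k; rewrite !weightE.
  + exists (Short i); first by rewrite pos_rootE.
    by move=> k; rewrite !weightE addrC.
Qed.

(** An additive invariant that leaves only three shapes of decompositions of
    epsilon_i + epsilon_j: a difference and a sum in either order, or two short
    roots. *)
Definition weight_sum b : int :=
  match b with Sub _ _ => 0 | Add _ _ => 2 | Short _ => 1 end.

Lemma weight_sumE b : weight_sum b = \sum_k weight b 0 k.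
Proof.
have sum1 r : \sum_k (k == r)%:R = 1 :> int.
  by rewrite (bigD1 r) //= eqxx big1 ?addr0 // => k /negbTE ->.
by case: b => [r s|r s|r]; under eq_bigr do rewrite weightE;
  rewrite ?sumrB ?big_split /= ?sum1 ?subrr.
Qed.

Lemma singular_singularb short i j b : (i < j)%N ->
  singular (pos_root short) (Add i j) b -> singularb short i j b.
Proof.
move=> ij [bp [c cp] bcE].
have E k : weight b 0 k + weight c 0 k = weight (Add i j) 0 k.
  by rewrite -bcE [RHS]mxE.
have S : weight_sum b + weight_sum c = 2.
  rewrite -[RHS]/(weight_sum (Add i j)) !weight_sumE -big_split.
  by apply: eq_bigr => k _; apply: E.
rewrite !pos_rootE in bp cp.
case: b c E S bp cp {bcE} => [r s|r s|r] [u v|u v|u] // E _ bp cp;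
  rewrite /singularb -!val_eqE /=.
- have Er := E r; have Es := E s; rewrite !weightE !natz -!val_eqE /= in Er Es.
  rewrite bp /=; clear E.
  have ri : (r == i :> nat) || (r == j :> nat) by clear Es; lia.
  have sj : (s != j :> nat) by clear Er ri; lia.
  by clear Er Es; lia.
- have Er := E r; have Es := E s; have Eu := E u; have Ev := E v.
  rewrite !weightE !natz -!val_eqE /= in Er Es Eu Ev; clear E.
  have ui : (u == i :> nat) || (u == j :> nat) by clear Er Es Ev; lia.
  rewrite bp /=.
  have [vr|vs] : v = r :> nat \/ v = s :> nat by clear Er Es Eu; lia.
    have sij : (s == i :> nat) || (s == j :> nat) by clear Er Eu Ev; lia.
    by clear Er Es Eu Ev; lia.
  have rij : (r == i :> nat) || (r == j :> nat) by clear Es Eu Ev; lia.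
  have ru : r <> u :> nat by clear Es Eu Ev; lia.
  by clear Er Es Eu Ev; lia.
- have Er := E r; rewrite !weightE !natz -!val_eqE /= in Er.
  by rewrite bp /=; lia.
Qed.

End SingularRoots.

(** * Prescribed values *)

Section PrescribedExt.

Variables (R : realType) (n : nat) (i j : 'I_n).
Hypothesis ij : (i < j)%N.

(** The prescribed values are polynomials in the values at singular roots, at
    epsilon_i + epsilon_j and at epsilon_i - epsilon_j.  The values at short roots
    are compared even in type D, where the formulas of type B are used with
    value 0 there. *)
Lemma prescribedB_ext (F F' : bdroot n -> R[i]) b v :
  F (Add i j) = F' (Add i j) -> F (Sub i j) = F' (Sub i j) ->
  (forall c, singularb true i j c -> F c = F' c) ->
  prescribedB i j F b v -> prescribedB i j F' b v.
Proof.
move=> Ftop Fdiff FF'.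
have Isub (s : 'I_n) : (i < s)%N -> F (Sub i s) = F' (Sub i s).
  have [->//|sj] := eqVneq s j.
  by move=> si; apply: FF'; rewrite /= si eqxx sj.
have Jadd (r : 'I_n) : (i <= r)%N -> (r < j)%N -> F (Add r j) = F' (Add r j).
  have [->//|ri] := eqVneq r i.
  move: ri; rewrite -val_eqE /= => ri ir rj; apply: FF'.
  have ir' : (i < r)%N by lia.
  by rewrite /= rj eqxx ir' !orbT.
have Ipm plus (s : 'I_n) : (j < s)%N -> F (PM plus i s) = F' (PM plus i s).
  move=> js; have si := ltn_trans ij js; case: plus; last exact: Isub.
  by apply: FF'; rewrite /= si eqxx js.
have Jpm plus (s : 'I_n) : (j < s)%N -> F (PM plus j s) = F' (PM plus j s).
  by move=> js; case: plus; apply: FF'; rewrite /= js eqxx !orbT.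
have Iadd (s : 'I_n) : (j < s)%N -> F (Add i s) = F' (Add i s) := @Ipm true s.
have Jadd' (s : 'I_n) : (j < s)%N -> F (Add j s) = F' (Add j s) := @Jpm true s.
have Ish : F (Short i) = F' (Short i) by apply: FF'; rewrite /= eqxx.
have Jsh : F (Short j) = F' (Short j) by apply: FF'; rewrite /= eqxx orbT.
case=> {b v} [|r s ir rs sj|r ir rj|plus r s ir rj js|plus r s jr rs
  |r ir rj|r jr].
- exact: prescribedB_top.
- by rewrite Isub ?Jadd //; [exact: prescribedB_sub|lia..].
- rewrite Jadd // Ish (eq_bigr (fun k => F' (Sub i k) * F' (Add i k))).
    exact: prescribedB_subj.
  by move=> k jk; rewrite Iadd // Isub //; exact: ltn_trans jk.
- by rewrite Ipm // Jadd ?(ltnW ir) //; exact: prescribedB_mid.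
- rewrite !(Jadd', Jpm, Ipm, Iadd) //; try exact: ltn_trans rs.
  exact: prescribedB_far.
- by rewrite Ish Jadd ?(ltnW ir) //; exact: prescribedB_short_mid.
- by rewrite Ish Jsh Jadd' // Iadd //; exact: prescribedB_short_far.
Qed.

(** Makes type D the case of type B in which the short roots have value 0, so
    that both types can be treated at once. *)
Lemma prescribedD_B (F : bdroot n -> R[i]) b v :
  (forall r, F (Short r) = 0) -> posD b ->
  prescribedD i j F b v <-> prescribedB i j F b v.
Proof.
move=> F0 bD.
have dropsq (S : R[i]) : - S = - 2^-1 * F (Short i) ^+ 2 - S.
  by rewrite F0 expr0n mulr0 add0r.
split=> [|bv].
  case=> {b v bD} [|r s ir rs sj|r ir rj|plus r s ir rj js|plus r s jr rs].
  - exact: prescribedB_top.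
  - exact: prescribedB_sub.
  - by rewrite dropsq; exact: prescribedB_subj.
  - exact: prescribedB_mid.
  - exact: prescribedB_far.
case: bv bD =>
  {b v} [|r s ir rs sj|r ir rj|plus r s ir rj js|plus r s jr rs|//|//] _.
- exact: prescribedD_top.
- exact: prescribedD_sub.
- by rewrite -dropsq; exact: prescribedD_subj.
- exact: prescribedD_mid.
- exact: prescribedD_far.
Qed.

End PrescribedExt.

Section RootValues.

Variables (R : realType) (n N : nat) (short : bool).
Variables (idx : 'I_n -> 'I_N) (mid : 'I_N).
Hypotheses (NE : N = (short + n.*2)%N) (idxE : forall r, idx r = r :> nat).
Hypothesis midE : short -> mid = n :> nat.
Local Notation C := R[i].
Local Notation idx' r := (rev_ord (idx r)).

Definition root_row (b : bdroot n) : 'I_N :=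
  match b with Sub r _ | Add r _ | Short r => idx r end.

Definition root_col (b : bdroot n) : 'I_N :=
  match b with Sub _ s => idx s | Add _ s => idx' s | Short _ => mid end.

Lemma idx_cases (a : 'I_N) :
  [\/ exists r, a = idx r, exists r, a = idx' r | short /\ a = mid].
Proof.
have aN := ltn_ord a.
have [an|na] := ltnP a n.
  by constructor 1; exists (Ordinal an); apply: val_inj; rewrite /= idxE.
have [a'n|na'] := ltnP (rev_ord a) n.
  constructor 2; exists (Ordinal a'n); apply: val_inj.
  by rewrite /= idxE /=; lia.
constructor 3; have sh : short by move: na' => /=; lia.
by split=> //; apply: val_inj; rewrite /= midE // ; move: na' => /=; lia.
Qed.

Lemma rev_mid : short -> rev_ord mid = mid.
Proof. by move=> sh; apply: val_inj; rewrite /= midE //; lia. Qed.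

(** Splits the isotropy relation into contributions of indices of roots. *)
Lemma sum_idx (G : 'I_N -> C) : \sum_a G a =
  \sum_r G (idx r) + \sum_r G (idx' r) + short%:R * G mid.
Proof.
have low (H : 'I_N -> C) : \sum_(a : 'I_N | (a < n)%N) H a = \sum_r H (idx r).
  have nN : (n <= N)%N by lia.
  rewrite (big_ord_narrow nN); apply: eq_bigr => r _; congr H.
  by apply: val_inj; rewrite /= idxE.
rewrite (bigID (fun a : 'I_N => (a < n)%N)) /= low -addrA; congr (_ + _).
rewrite (bigID (fun a : 'I_N => (rev_ord a < n)%N)) /=; congr (_ + _).
  rewrite (reindex_inj rev_ord_inj) -(low (fun a => G (rev_ord a))).
  apply: eq_bigl => a.
  by rewrite /=; move: (ltn_ord a); lia.
case: (boolP short) => sh; rewrite ?mul1r ?mul0r.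
  rewrite (big_pred1 mid) // => a; rewrite /= -val_eqE /= midE //.
  by move: (ltn_ord a); lia.
by rewrite big1 // => a; move: (ltn_ord a); lia.
Qed.

Variables (i j : 'I_n).
Hypothesis ij : (i < j)%N.

(** With u = idx r and u' = rev u, the coordinates p (u') for r < j and q (u')
    for r < i vanish, so in each case of the table the minor at a root collapses
    to one or two products.  The normalization identifies the factors with
    values of F at singular roots.  The one coordinate that is not such a value
    is p (idx j), which the isotropy of p expresses through the others; this is
    the quadratic formula for epsilon_r - epsilon_j. *)
Lemma plucker_takes_values p q (F : bdroot n -> C) :
  normalized_pair (idx i) (idx j) p q ->
  (forall b, pos_root short b -> F b = plucker p q (root_row b) (root_col b)) ->
  (~~ short -> forall r, F (Short r) = 0) ->
  takes_values (regular (pos_root short) (Add i j)) (prescribedB i j F) F.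
Proof.
case=> -[pj p0] [qi q0] qj pp FE F0.
have p'0 (r : 'I_n) : (r < j)%N -> p (idx' r) = 0.
  by move=> rj; apply: p0; rewrite /= !idxE; move: (ltn_ord r) (ltn_ord j); lia.
have q'0 (r : 'I_n) : (r < i)%N -> q (idx' r) = 0.
  by move=> rj; apply: q0; rewrite /= !idxE; move: (ltn_ord r) (ltn_ord i); lia.
have p'i := p'0 i ij.
have FSub (r s : 'I_n) : (r < s)%N ->
    F (Sub r s) = q (idx' r) * p (idx s) - q (idx s) * p (idx' r).
  by move=> rs; rewrite FE ?pos_rootE.
have FAdd (r s : 'I_n) : (r < s)%N ->
    F (Add r s) = q (idx' r) * p (idx' s) - q (idx' s) * p (idx' r).
  by move=> rs; rewrite FE ?pos_rootE.
have FShort (r : 'I_n) : F (Short r) =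
    short%:R * (q (idx' r) * p mid - q mid * p (idx' r)).
  case: (boolP short) => sh; last by rewrite F0 ?mul0r.
  by rewrite FE ?pos_rootE // mul1r.
have FPM plus (r s : 'I_n) : (r < s)%N -> F (PM plus r s) =
   q (idx' r) * p (if plus then idx' s else idx s)
   - q (if plus then idx' s else idx s) * p (idx' r).
  by case: plus; [apply: FAdd | apply: FSub].
have pjE : p (idx j) = - 2^-1 * F (Short i) ^+ 2
    - \sum_(k < n | (j < k)%N) F (Sub i k) * F (Add i k).
  (* In the isotropy relation the indices idx k and idx' k contribute the same
     product, which vanishes for k < j and is p (idx j) for k = j. *)
  pose S := \sum_(k < n | (j < k)%N) p (idx k) * p (idx' k).
  have -> : \sum_(k < n | (j < k)%N) F (Sub i k) * F (Add i k) = S.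
    apply: eq_bigr => k jk; have ik := ltn_trans ij jk.
    by rewrite FSub // FAdd // qi p'i !mulr0 !mul1r !subr0.
  have half : \sum_r p (idx r) * p (idx' r) = p (idx j) + S.
    rewrite (bigID (fun r : 'I_n => (r < j)%N)) /= big1 => [|r rj].
      rewrite add0r (bigD1 j) ?ltnn //= pj mulr1; congr (_ + _).
      apply: eq_bigl => r.
      by rewrite -leqNgt -val_eqE /= ltn_neqAle andbC eq_sym.
    by rewrite p'0 ?mulr0.
  rewrite sum_idx in pp.
  rewrite half [X in _ + X + _](eq_bigr (fun r => p (idx r) * p (idx' r)))
    in pp; last by move=> r _; rewrite rev_ordK mulrC.
  have midpp : short%:R * (p mid * p (rev_ord mid)) = F (Short i) ^+ 2.
    rewrite FShort qi p'i; case: (boolP short) => sh.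
      by rewrite mulr1n rev_mid //; ring.
    by rewrite !mul0r expr0n.
  rewrite half midpp in pp.
  transitivity (p (idx j)
    - 2^-1 * (p (idx j) + S + (p (idx j) + S) + F (Short i) ^+ 2)).
    by rewrite pp mulr0 subr0.
  by field.
move=> b [bp bns]; have {bns} bh : ~ singularb short i j b.
  by move=> /(singularb_singular ij).
split=> [v|].
  case=> {b v bp bh} [|r s ir rs sj|r ir rj|plus r s ir rj js|plus r s jr rs
    |r ir rj|r jr].
  - by rewrite FAdd // qi pj p'i; ring.
  - have rj := leq_trans rs sj.
    by rewrite !FSub ?FAdd ?(leq_ltn_trans ir) // qi p'i pj qj p'0 //; ring.
  - by rewrite -pjE FSub // FAdd // pj qj p'0 //; ring.
  - have rs := ltn_trans rj js.
    by rewrite !FPM ?(ltn_trans ir) // FAdd // qi p'i pj qj p'0 //; ring.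
  - have js := ltn_trans jr rs; have ir := ltn_trans ij jr.
    by rewrite !FPM ?(ltn_trans ij js) // !FAdd // qi p'i pj qj; ring.
  - by rewrite !FShort FAdd // qi p'i pj qj p'0 //; ring.
  - have ir := ltn_trans ij jr.
    by rewrite !FShort !FAdd // qi p'i pj qj; ring.
have p'q' (r : 'I_n) : (r < i)%N -> p (idx' r) = 0 /\ q (idx' r) = 0.
  by move=> ri; rewrite p'0 ?q'0 //; exact: ltn_trans ij.
move=> nv; rewrite pos_rootE in bp; case: b bp bh nv => [r s|r s|r] bp bh nv.
- rewrite FSub //; have [ri|ir] := ltnP r i.
    by have [-> ->] := p'q' r ri; rewrite mul0r mulr0 subr0.
  have [sj|js] := leqP s j; first by case: (nv _ (prescribedB_sub _ ir bp sj)).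
  have sj : s != j by rewrite -val_eqE /= gtn_eqF.
  case: (ltngtP r j) => [rj|jr|/ord_inj rj].
  + case: (ltngtP i r) ir => [ir _|//|/ord_inj ir _].
      by case: (nv _ (prescribedB_mid _ false ir rj js)).
    by case: bh; rewrite /= bp -ir eqxx sj.
  + by case: (nv _ (prescribedB_far _ _ false jr bp)).
  + by case: bh; rewrite /= bp rj eqxx orbT.
- rewrite FAdd //; have [ri|ir] := ltnP r i.
    by have [-> ->] := p'q' r ri; rewrite mul0r mulr0 subr0.
  case: (ltngtP s j) => [sj|js|/ord_inj sj].
  + by rewrite !p'0 ?mulr0 ?subr0 //; exact: ltn_trans sj.
  + case: (ltngtP r j) => [rj|jr|/ord_inj rj].
    * case: (ltngtP i r) ir => [ir _|//|/ord_inj ir _].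
        by case: (nv _ (prescribedB_mid _ true ir rj js)).
      by case: bh; rewrite /= bp -ir eqxx js.
    * by case: (nv _ (prescribedB_far _ _ true jr bp)).
    * by case: bh; rewrite /= bp rj eqxx !orbT.
  + subst s; case: (ltngtP i r) ir => [ir _|//|/ord_inj ir _].
      by case: bh; rewrite /= bp ir eqxx orbT.
    by subst r; case: (nv _ (prescribedB_top _ _ _)).
- have [ri|ir] := ltnP r i.
    by rewrite FShort; have [-> ->] := p'q' r ri; ring.
  case: (ltngtP r j) => [rj|jr|/ord_inj rj].
  + case: (ltngtP i r) ir => [ir _|//|/ord_inj ir _].
      by case: (nv _ (prescribedB_short_mid _ ir rj)).
    by case: bh; rewrite /= bp -ir eqxx.
  + by case: (nv _ (prescribedB_short_far _ _ jr)).
  + by case: bh; rewrite /= bp rj eqxx orbT.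
Qed.

End RootValues.

(** * The orbit in terms of root vectors *)

Section GenericOrbit.

Variables (R : realType) (n N : nat) (short : bool).
Variables (idx : 'I_n -> 'I_N) (mid : 'I_N) (e : bdroot n -> nil_lie R N).
Hypotheses (NE : N = (short + n.*2)%N) (idxE : forall r, idx r = r :> nat).
Hypothesis midE : short -> mid = n :> nat.
Local Notation C := R[i].
Local Notation idx' r := (rev_ord (idx r)).
Local Notation pos := (pos_root short).
Local Notation row := (root_row idx).
Local Notation col := (root_col idx mid).
Hypothesis eE :
  forall b, pos b -> nil_lie_mx (e b) = skew_delta R (row b) (col b).
Hypothesis e0 : ~~ short -> forall r, e (Short r) = 0.
Implicit Types f phi : {scalar nil_lie R N}.

(** Above the diagonal, E_ab - E_b'a' is a root vector up to sign, or 0. *)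
Lemma eq_on_roots f f' :
  (forall b, pos b -> f (e b) = f' (e b)) -> f =1 f'.
Proof.
move=> ff'.
pose agree a b := forall x, nil_lie_mx x = skew_delta R a b -> f x = f' x.
have agree_root b : pos b -> agree (row b) (col b).
  by move=> bp x; rewrite -eE // => /val_inj ->; apply: ff'.
have agreeN (a b : 'I_N) : agree a b -> agree (rev_ord b) (rev_ord a).
  move=> ab x xE; have /ab : nil_lie_mx (- x) = skew_delta R a b.
    by rewrite -[LHS]/(- nil_lie_mx x) xE skew_delta_rev opprK.
  by rewrite !linearN => /oppr_inj.
suff H (a b : 'I_N) : (a < b)%N -> agree a b.
  by apply: eq_on_skew_delta => a b x /H; apply.
have [[r ->]|[r ->]|[sh ->]] := idx_cases NE idxE midE a;
have [[s ->]|[s ->]|[sh' ->]] := idx_cases NE idxE midE b => ab.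
- by apply: (agree_root (Sub r s)); rewrite pos_rootE -!idxE.
- have [rs|sr|/ord_inj rs] := ltngtP r s.
  + by apply: (agree_root (Add r s)); rewrite pos_rootE.
  + have := agreeN _ _ (agree_root (Add s r) _); rewrite /= rev_ordK.
    by apply; rewrite pos_rootE.
  + subst s => x; rewrite /skew_delta rev_ordK subrr.
    by move=> /(@val_inj _ _ _ x 0) ->; rewrite !linear0.
- by apply: (agree_root (Short r)); rewrite pos_rootE.
- by move: ab; rewrite /= !idxE; move: (ltn_ord r) (ltn_ord s); lia.
- have := agreeN _ _ (agree_root (Sub s r) _); apply.
  by rewrite pos_rootE; move: ab; rewrite /= !idxE; lia.
- by move: ab; rewrite /= midE // !idxE; move: (ltn_ord r); lia.
- by move: ab; rewrite /= midE // !idxE; move: (ltn_ord s); lia.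
- have := agreeN _ _ (agree_root (Short s) _); rewrite /= (rev_mid NE) //.
  by apply; rewrite pos_rootE.
- by rewrite ltnn in ab.
Qed.

Lemma interpolate (g h : 'I_n -> C) (m : C) : exists p : 'I_N -> C,
  [/\ forall r, p (idx r) = g r, forall r, p (idx' r) = h r
    & short -> p mid = m].
Proof.
case: (posnP n) => [n0|n0].
  have no (r : 'I_n) : False.
    by move: (ltn_ord r); rewrite [in X in (_ < X)%N]n0.
  by exists (fun=> m); split=> // r; case: (no r).
pose o : 'I_n := Ordinal n0.
exists (fun c : 'I_N => if (c < n)%N then g (insubd o (c : nat)) else
   if (rev_ord c < n)%N then h (insubd o (rev_ord c : nat)) else m).
have oK (r : 'I_n) (c : nat) : c = r :> nat -> insubd o c = r.
  by move=> ->; apply: val_inj; rewrite val_insubd ltn_ord.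
split=> [r|r|sh].
- by rewrite idxE ltn_ord (oK r).
- have -> : (idx' r < n)%N = false by rewrite /= idxE; move: (ltn_ord r); lia.
  by rewrite rev_ordK idxE ltn_ord (oK r).
- by rewrite (rev_mid NE midE) // midE // ltnn.
Qed.

Variables i j : 'I_n.
Hypothesis ij : (i < j)%N.

Lemma idx_mono (r s : 'I_n) : (idx r < idx s)%N = (r < s)%N.
Proof. by rewrite !idxE. Qed.

Lemma idx_lt_rev (r s : 'I_n) : (idx r < idx' s)%N.
Proof. by rewrite /= !idxE; move: (ltn_ord r) (ltn_ord s); lia. Qed.

Definition matrix_entry a b (x : nil_lie R N) : C := nil_lie_mx x a b.

Lemma matrix_entry_linear a b : scalar (matrix_entry a b).
Proof. by move=> k x y; rewrite /matrix_entry /= !mxE. Qed.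

HB.instance Definition _ a b := GRing.isLinear.Build C (nil_lie R N) C _
  (matrix_entry a b) (matrix_entry_linear a b).

(** The functional dual to the root vector of epsilon_i + epsilon_j reads off one
    matrix entry, which brings the orbit under the description by minors. *)
Lemma matrix_entry_dual :
  is_dual_multiple pos e (Add i j) 1 (matrix_entry (idx i) (idx' j)).
Proof.
have idx_inj : injective idx.
  by move=> r s rs; apply: ord_inj; rewrite -!idxE rs.
have noidx r s : (idx r == idx' s) = false.
  by rewrite -val_eqE; apply: ltn_eqF; apply: idx_lt_rev.
have noidx' r s : (idx' s == idx r) = false by rewrite eq_sym.
have entE b : pos b -> matrix_entry (idx i) (idx' j) (e b) =
    ((idx i == row b) && (idx' j == col b))%:R
    - ((idx i == rev_ord (col b)) && (idx' j == rev_ord (row b)))%:R.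
  by move=> bp; rewrite /matrix_entry eE // !mxE.
split=> [|b bp bij]; rewrite /= entE // ?pos_rootE //.
  rewrite rev_ordK (inj_eq rev_ord_inj) !(inj_eq idx_inj) !eqxx.
  by rewrite -val_eqE /= ltn_eqF ?subr0.
case: b bp bij => [r s|r s|r] bp bij; rewrite /root_row /root_col.
- by rewrite noidx noidx' andbF subr0.
- rewrite rev_ordK !(inj_eq rev_ord_inj) !(inj_eq idx_inj).
  rewrite pos_rootE in bp; have -> : (i == s) && (j == r) = false.
    by apply/negP => /andP[/eqP is_ /eqP jr]; move: bp; rewrite -is_ -jr; lia.
  rewrite subr0; case: (i =P r) => // ir; case: (j =P s) => // js.
  by case: bij; rewrite ir js.
- rewrite pos_rootE in bp; rewrite (rev_mid NE midE) //.
  have midN (s : 'I_n) : (idx s == mid) = false.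
    by rewrite -val_eqE /= idxE midE // ltn_eqF.
  by rewrite midN -(rev_mid NE midE bp) (inj_eq rev_ord_inj) midN andbF subr0.
Qed.

Lemma elementary_orbitE f :
  elementary_orbit pos e (Add i j) 1 f <-> orbit_of_entry (idx i) (idx j) f.
Proof.
split=> [[phi [phi1 phi0] orb] | orb].
  have [m1 m0] := matrix_entry_dual.
  have phiE x : phi x = nil_lie_mx x (idx i) (idx' j).
    apply: (eq_on_roots (f' := matrix_entry (idx i) (idx' j))) => b bp.
    have [->|nb] := pselect (b = Add i j); first by rewrite phi1 m1.
    by rewrite phi0 // m0.
  by apply/(coadjoint_orbit_of_entry f phiE).
exists (matrix_entry (idx i) (idx' j)); first exact: matrix_entry_dual.
have entryE x : (matrix_entry (idx i) (idx' j) : {scalar _}) x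
    = nil_lie_mx x (idx i) (idx' j) by [].
by apply/(coadjoint_orbit_of_entry f entryE).
Qed.

Lemma orbit_takes_values f : elementary_orbit pos e (Add i j) 1 f ->
  takes_values (regular pos (Add i j)) (prescribedB i j (fun b => f (e b)))
    (fun b => f (e b)).
Proof.
have IJ : (idx i < idx j)%N by rewrite idx_mono.
move=> /elementary_orbitE /(orbit_plucker IJ (idx_lt_rev j j)) [p [q [pq fE]]].
apply: (plucker_takes_values NE idxE midE ij pq) => [b bp|sh r].
  by apply: fE; rewrite eE.
by rewrite e0 // linear0.
Qed.

(** At a singular root one of the two products of the minor vanishes and the
    other one has a factor 1, so that the value is, up to sign, a free coordinate
    of one of the two columns. *)
Lemma orbit_with_singular_values (v : bdroot n -> C) :
  exists2 f, elementary_orbit pos e (Add i j) 1 f &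
    forall b, singularb short i j b -> f (e b) = v b.
Proof.
have [p [p1 p2 p3]] :=
  interpolate (fun s => v (Sub i s)) (fun s => v (Add i s)) (v (Short i)).
have [q [q1 q2 q3]] := interpolate (fun s => - v (Sub j s))
  (fun s => if (s < j)%N then v (Add s j) else - v (Add j s)) (- v (Short j)).
have IJ : (idx i < idx j)%N by rewrite idx_mono.
have [f orb [P [Q [[[Pj P0] [Qi Q0] Qj _] fE pE qE]]]] :=
  orbit_realize p q IJ (idx_lt_rev j j).
exists f; first exact/elementary_orbitE.
have P'i : P (idx' i) = 0.
  by apply: P0; rewrite /= !idxE; move: (ltn_ord i) (ltn_ord j); lia.
have f_plucker b : pos b -> f (e b) = plucker P Q (row b) (col b).
  by move=> bp; apply: fE; rewrite eE.
have rev_mono (r s : 'I_n) : (idx' r < idx' s)%N = (s < r)%N.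
  by rewrite /= !idxE; move: (ltn_ord r) (ltn_ord s); lia.
have idx_eq (r s : 'I_n) : (idx r == idx s) = (r == s).
  by rewrite -val_eqE /= !idxE.
have noidx (r s : 'I_n) : (idx r != idx' s).
  by rewrite -val_eqE /= ltn_eqF // idx_lt_rev.
have mid_range : short -> [/\ (idx i < mid)%N, (idx j < mid)%N,
   (mid < idx' j)%N & (mid < idx' i)%N].
  move=> sh; rewrite /= !idxE midE //.
  by move: (ltn_ord i) (ltn_ord j); split=> //; lia.
case=> [r s|r s|r] /andP[rs].
- case/orP=> [/andP[/eqP ri sj]|/eqP rj]; subst r;
    rewrite f_plucker ?pos_rootE // /plucker /=.
  + rewrite Qi P'i mulr0 subr0 mul1r pE ?p1 ?idx_eq //.
    by rewrite idx_mono rs idx_lt_rev.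
  + by rewrite Qj Pj mul0r mulr1 sub0r qE ?q1 ?opprK // idx_mono rs idx_lt_rev.
- case/or3P=> [/andP[/eqP ri js]|/andP[/eqP sj ir]|/eqP rj];
    rewrite f_plucker ?pos_rootE // /plucker /=.
  + subst r; rewrite Qi P'i mulr0 subr0 mul1r pE ?p2 //.
      by rewrite rev_mono js idx_lt_rev.
    by rewrite eq_sym noidx.
  + subst s; rewrite Qj Pj mul0r mulr1 subr0 qE ?q2 ?rs //.
      by rewrite rev_mono ir idx_lt_rev.
    by rewrite (inj_eq rev_ord_inj) idx_eq -val_eqE /= ltn_eqF.
  + subst r; rewrite Qj Pj mul0r mulr1 sub0r qE ?q2.
    * by rewrite ltnNge ltnW //= opprK.
    * by rewrite rev_mono (ltn_trans ij rs) idx_lt_rev.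
    * by rewrite (inj_eq rev_ord_inj) idx_eq -val_eqE /= gtn_eqF.
- have [im jm mj mi] := mid_range rs.
  case/orP=> /eqP re; subst r; rewrite f_plucker ?pos_rootE // /plucker /=.
  + rewrite Qi P'i mulr0 subr0 mul1r pE ?p3 //; first by rewrite im mj.
    by rewrite -val_eqE gtn_eqF.
  + rewrite Qj Pj mul0r mulr1 sub0r qE ?q3 ?opprK //; first by rewrite jm mi.
    by rewrite -val_eqE ltn_eqF.
Qed.

(** Some point f' of the orbit agrees with f at the singular roots.  It satisfies
    the same equations, and these determine all other values. *)
Lemma takes_values_orbit f :
  takes_values (regular pos (Add i j)) (prescribedB i j (fun b => f (e b)))
    (fun b => f (e b)) ->
  elementary_orbit pos e (Add i j) 1 f.
Proof.
move=> fv; have [f' orb f'E] := orbit_with_singular_values (fun b => f (e b)).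
have f'v := orbit_takes_values orb.
suff ff' : f =1 f'.
  have [y yE] := (elementary_orbitE f').1 orb.
  by apply/elementary_orbitE; exists y => x; rewrite ff' yE.
have hook b : singularb true i j b -> f (e b) = f' (e b).
  case: (boolP short) => sh hb.
    by rewrite f'E // sh.
  case: b hb => [r s|r s|r] hb; [by rewrite f'E | by rewrite f'E |].
  by rewrite e0 // !linear0.
have reg b : pos b -> ~~ singularb short i j b -> regular pos (Add i j) b.
  by move=> bp /negP nb; split=> // /(singular_singularb ij).
have top : f (e (Add i j)) = f' (e (Add i j)).
  have rtop : regular pos (Add i j) (Add i j).
    apply: reg; rewrite ?pos_rootE //=.
    by rewrite !ltnn !andbF -val_eqE /= ltn_eqF // andbF.
  rewrite ((fv _ rtop).1 _ (prescribedB_top _ _ _)).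
  by rewrite ((f'v _ rtop).1 _ (prescribedB_top _ _ _)).
have diff : f (e (Sub i j)) = f' (e (Sub i j)).
  have rdiff : regular pos (Add i j) (Sub i j).
    by apply: reg; rewrite ?pos_rootE //= !eqxx -val_eqE /= ltn_eqF // andbF.
  have ii := leqnn i.
  rewrite ((fv _ rdiff).1 _ (prescribedB_subj _ ii ij)).
  rewrite ((f'v _ rdiff).1 _ (prescribedB_subj _ ii ij)) top.
  rewrite (hook (Short i)) /= ?eqxx //.
  congr (_ * (_ - _)); apply: eq_bigr => k jk; have ik := ltn_trans ij jk.
  by rewrite !hook //= ?ik eqxx ?jk // -val_eqE gtn_eqF.
apply: eq_on_roots => b bp; have [bh|bh] := boolP (singularb short i j b).
  by rewrite f'E.
have [fp f0] := fv _ (reg _ bp bh); have [f'p f'0] := f'v _ (reg _ bp bh).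
have [[w bw]|nw] := pselect (exists w, prescribedB i j (fun b => f (e b)) b w).
  by rewrite (fp _ bw) (f'p w) //; exact: (prescribedB_ext ij top diff hook bw).
rewrite f0 ?f'0 // => w bw; apply: nw; exists w => //.
by apply: (prescribedB_ext ij _ _ _ bw) => // c /hook.
Qed.

Theorem orbit_description :
  (forall f, elementary_orbit pos e (Add i j) 1 f <->
     takes_values (regular pos (Add i j)) (prescribedB i j (fun b => f (e b)))
       (fun b => f (e b)))
  /\ (forall v : bdroot n -> C,
        exists2 f, elementary_orbit pos e (Add i j) 1 f &
        forall b, singular pos (Add i j) b -> f (e b) = v b).
Proof.
split=> [f | v].
  by split; [exact: orbit_takes_values | exact: takes_values_orbit].
have [f orb fE] := orbit_with_singular_values v; exists f => // b.
by move=> /(singular_singularb ij) /fE.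
Qed.

End GenericOrbit.

Lemma takes_values_iff (n : nat) (T : nmodType) (D : bdroot n -> Prop)
    (P P' : bdroot n -> T -> Prop) F :
  (forall b v, D b -> P b v <-> P' b v) -> takes_values D P F <->
  takes_values D P' F.
Proof.
move=> PP'; split=> DF b bD; have [FP F0] := DF b bD; split=> [v|nP].
- by move=> /(PP' b v bD).2; apply: FP.
- by apply: F0 => v /(PP' b v bD).1; apply: nP.
- by move=> /(PP' b v bD).1; apply: FP.
- by apply: F0 => v /(PP' b v bD).2; apply: nP.
Qed.

Lemma eB_skew_delta (R : realType) (n : nat) (b : bdroot n) : posB b ->
  nil_lie_mx (eB R b)
  = skew_delta R (root_row (@idxB n) b) (root_col (@idxB n) (midB n) b).
Proof.
move=> bp; rewrite eB_mxE //.
case: b {bp} => [r s|r s|r]; rewrite /skew_delta //= ?rev_ordK //.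
by congr (_ - delta_mx _ _); apply: val_inj => /=; lia.
Qed.

Lemma eD_skew_delta (R : realType) (n : nat) (mid : 'I_n.*2) (b : bdroot n) :
  posD b ->
  nil_lie_mx (eD R b)
  = skew_delta R (root_row (@idxD n) b) (root_col (@idxD n) mid b).
Proof.
move=> bp; rewrite eD_mxE //.
by case: b bp => [r s|r s|r] // _; rewrite /skew_delta /= ?rev_ordK.
Qed.

Lemma eD_short (R : realType) (n : nat) (r : 'I_n) : eD R (Short r) = 0.
Proof. by rewrite /eD /insubd; case: insubP => // u _ u0; apply: val_inj. Qed.

Theorem theorem4p3 (R : realType) (n : nat) (i j : 'I_n) (hij : (i < j)%N) :
  ((forall f : {scalar BLie R n},
      elementary_orbit (@posB n) (@eB R n) (Add i j) 1 f <->
      takes_values (regular (@posB n) (Add i j))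
        (prescribedB i j (fun b => f (eB R b))) (fun b => f (eB R b)))
   /\ (forall v : bdroot n -> R[i],
        exists2 f : {scalar BLie R n},
          elementary_orbit (@posB n) (@eB R n) (Add i j) 1 f &
          forall b, singular (@posB n) (Add i j) b -> f (eB R b) = v b))
  /\
  ((forall f : {scalar DLie R n},
      elementary_orbit (@posD n) (@eD R n) (Add i j) 1 f <->
      takes_values (regular (@posD n) (Add i j))
        (prescribedD i j (fun b => f (eD R b))) (fun b => f (eD R b)))
   /\ (forall v : bdroot n -> R[i],
        exists2 f : {scalar DLie R n},
          elementary_orbit (@posD n) (@eD R n) (Add i j) 1 f &
          forall b, singular (@posD n) (Add i j) b -> f (eD R b) = v b)).
Proof.
split.
  apply: (@orbit_description R n n.*2.+1 true (@idxB n) (midB n) (@eB R n)) => //.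
  exact: eB_skew_delta.
(* There is no middle index: any index takes its place. *)
have [orbD valD] := @orbit_description R n n.*2 false
  (@idxD n) (idxD i) (@eD R n) erefl (fun=> erefl) (fun h => False_ind _ (notF h))
  (@eD_skew_delta R n (idxD i)) (fun _ r => eD_short R r) i j hij.
split=> // f; apply: (iff_trans (orbD f)).
apply: takes_values_iff => b v [bp _]; apply: iff_sym.
by apply: prescribedD_B => // r; rewrite eD_short linear0.
Qed.
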